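(* Let $Q$ be a commutative ring and let $R$ be an associative and flat $Q$-algebra. If $E$ is a semidualizing $Q$-module, then ${}_RC_R=E\otimes_Q{}_RR_R$ is a faithfully semidualizing $(R,R)$-bimodule.
   Context: Rings are associative with unity (not necessarily noetherian). Modules are unital left modules; right $R$-modules are identified with left $R^{\mathrm{op}}$-modules. ''Flat $Q$-algebra'' means a $Q$-algebra that is flat as a $Q$-module. A module $E$ over a commutative ring $Q$ is semidualizing if it admits a projective resolution by finitely generated projective $Q$-modules, the homothety map $Q\to\operatorname{Hom}_Q(E,E)$ is an isomorphism, and $\operatorname{Ext}_Q^i(E,E)=0$ for all $i\ge1$. For rings $S,R$, an $(S,R)$-bimodule $C={}_SC_R$ is semidualizing if: (a1) ${}_SC$ admits a degreewise finite $S$-projective resolution (a projective resolution by finitely generated projectives); (a2) $C_R$ admits a degreewise finite $R^{\mathrm{op}}$-projective resolution; (b1) the homothety map $S\to\operatorname{Hom}_{R^{\mathrm{op}}}(C,C)$, $s\mapsto(x\mapsto sx)$, is an isomorphism; (b2) the homothety map $R\to\operatorname{Hom}_S(C,C)$, $r\mapsto(x\mapsto xr)$, is an isomorphism; (c1) $\operatorname{Ext}_S^{i}(C,C)=0$ for all $i\geq1$; (c2) $\operatorname{Ext}_{R^{\mathrm{op}}}^{i}(C,C)=0$ for all $i\geq 1$. It is faithfully semidualizing if moreover, for all left $S$-modules $N$ and right $R$-modules $M$: $\operatorname{Hom}_S(C,N)=0$ implies $N=0$, and $\operatorname{Hom}_{R^{\mathrm{op}}}(C,M)=0$ implies $M=0$.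 (Here these are applied with $S=R$.) *)

(* Defs.v *)
From HB Require Import structures.
From mathcomp Require Import all_boot all_algebra.
From mathcomp Require Import boolp.

Set Implicit Arguments.
Unset Strict Implicit.
Unset Printing Implicit Defensive.

Import GRing.Theory.
Local Open Scope ring_scope.
Local Open Scope quotient_scope.

(* Associative unital algebras over a commutative ring. The structure algType
   of MathComp requires 1 != 0 in the algebra; here the zero ring is allowed,
   whence the "pz" (possibly zero) variant. The scaling is a new operation,
   since the structure hierarchy does not admit a common ancestor of
   pzRingType and lmodType below algType; see alg_mod for the Q-module. *)
HB.mixin Record PzRing_isPzAlgebra (Q : pzRingType) A of GRing.PzRing A := {
  ascale : Q -> A -> A;
  ascalerA : forall a b u, ascale a (ascale b u) = ascale (a * b) u;
  ascale1r : forall u, ascale 1 u = u;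
  ascalerDr : forall a u v, ascale a (u + v) = ascale a u + ascale a v;
  ascalerDl : forall u a b, ascale (a + b) u = ascale a u + ascale b u;
  ascalerAl : forall a u v, ascale a (u * v) = ascale a u * v;
  ascalerAr : forall a u v, ascale a (u * v) = u * ascale a v
}.
#[short(type="pzAlgType")]
HB.structure Definition PzAlgebra (Q : pzRingType) :=
  {A of GRing.PzRing A & PzRing_isPzAlgebra Q A}.

(* The underlying Q-module of a Q-algebra. *)
Definition alg_mod (Q : pzRingType) (A : pzAlgType Q) : Type := A.

Section AlgMod.
Variables (Q : pzRingType) (A : pzAlgType Q).

HB.instance Definition _ := GRing.Zmodule.on (alg_mod A).

Let asc (a : Q) (u : alg_mod A) : alg_mod A := ascale a (u : A).

Fact alg_mod_scalerA a b u : asc a (asc b u) = asc (a * b) u.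
Proof. exact: ascalerA. Qed.
Fact alg_mod_scale1r : left_id 1 asc.
Proof. exact: ascale1r. Qed.
Fact alg_mod_scalerDr : right_distributive asc +%R.
Proof. by move=> a u v; apply: ascalerDr. Qed.
Fact alg_mod_scalerDl u : {morph asc^~ u : a b / a + b}.
Proof. by move=> a b; apply: ascalerDl. Qed.

HB.instance Definition _ := GRing.Zmodule_isLmodule.Build Q (alg_mod A)
  alg_mod_scalerA alg_mod_scale1r alg_mod_scalerDr alg_mod_scalerDl.

End AlgMod.

(* (S,R)-bimodules: rscale x r is the product x r of x by r on the right. *)
HB.mixin Record Lmodule_isBimodule (S R : pzRingType) C
    of GRing.Lmodule S C := {
  rscale : C -> R -> C;
  rscalerA : forall x r r', rscale (rscale x r) r' = rscale x (r * r');
  rscaler1 : forall x, rscale x 1 = x;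
  rscalerDl : forall r x y, rscale (x + y) r = rscale x r + rscale y r;
  rscalerDr : forall x r r', rscale x (r + r') = rscale x r + rscale x r';
  scale_rscale : forall (s : S) x r, s *: rscale x r = rscale (s *: x) r
}.
#[short(type="bimodType")]
HB.structure Definition Bimodule (S R : pzRingType) :=
  {C of GRing.Lmodule S C & Lmodule_isBimodule S R C}.

(* The right R-module C_R, that is, C as a left module over R^c = R^op. *)
Definition right_mod (S R : pzRingType) (C : bimodType S R) : Type := C.

Section RightMod.
Variables (S R : pzRingType) (C : bimodType S R).

HB.instance Definition _ := GRing.Zmodule.on (right_mod C).

Let rsc (r : R^c) (x : right_mod C) : right_mod C := rscale (x : C) r.

Fact right_mod_scalerA a b x : rsc a (rsc b x) = rsc (a * b) x.
Proof. exact: rscalerA. Qed.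
Fact right_mod_scale1r : left_id 1 rsc.
Proof. exact: rscaler1. Qed.
Fact right_mod_scalerDr : right_distributive rsc +%R.
Proof. by move=> a x y; apply: rscalerDl. Qed.
Fact right_mod_scalerDl x : {morph rsc^~ x : a b / a + b}.
Proof. by move=> a b; apply: rscalerDr. Qed.

HB.instance Definition _ := GRing.Zmodule_isLmodule.Build R^c (right_mod C)
  right_mod_scalerA right_mod_scale1r right_mod_scalerDr right_mod_scalerDl.

Definition lmul (s : S) : right_mod C -> right_mod C :=
  fun x => s *: (x : C).

Fact lmul_linear s : linear (lmul s).
Proof.
move=> a x y; rewrite /lmul; change (s *: (rscale (x : C) a + y)
  = rscale (s *: (x : C)) a + s *: (y : C)).
by rewrite scalerDr scale_rscale.
Qed.
HB.instance Definition _ s := GRing.isLinear.Build R^c (right_mod C)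
  (right_mod C) _ (lmul s) (lmul_linear s).

Definition rmul (r : R) : C -> C := fun x => rscale x r.

Fact rmul_linear r : linear (rmul r).
Proof. by move=> a x y; rewrite /rmul rscalerDl scale_rscale. Qed.
HB.instance Definition _ r := GRing.isLinear.Build S C C _ (rmul r)
  (rmul_linear r).

Definition left_homothety (s : S) : {linear right_mod C -> right_mod C} :=
  lmul s.
Definition right_homothety (r : R) : {linear C -> C} := rmul r.

End RightMod.

Section Tensor.
Variables (Q : comPzRingType) (M N : lmodType Q).

(* The tensor product of M and N over Q: a list of pairs stands for the sum of
   the corresponding elementary tensors, and tens_rel is the congruence on these
   formal sums generated by the commutativity of the sum and the Q-bilinearity
   relations. Concatenation has inverses modulo tens_rel, so the quotient is
   the free abelian group on M * N modulo the bilinearity relations. *)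
Inductive tens_rel : seq (M * N) -> seq (M * N) -> Prop :=
| tens_rel_refl s : tens_rel s s
| tens_rel_sym s t : tens_rel s t -> tens_rel t s
| tens_rel_trans s t u : tens_rel s t -> tens_rel t u -> tens_rel s u
| tens_rel_cat s s' t t' :
    tens_rel s s' -> tens_rel t t' -> tens_rel (s ++ t) (s' ++ t')
| tens_rel_catC s t : tens_rel (s ++ t) (t ++ s)
| tens_rel_0l y : tens_rel [:: (0, y)] [::]
| tens_rel_Dl x x' y : tens_rel [:: (x + x', y)] [:: (x, y); (x', y)]
| tens_rel_Dr x y y' : tens_rel [:: (x, y + y')] [:: (x, y); (x, y')]
| tens_rel_Z a x y : tens_rel [:: (a *: x, y)] [:: (x, a *: y)].

Definition tens_relb (s t : seq (M * N)) : bool := `[< tens_rel s t >].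

Fact tens_relb_refl : reflexive tens_relb.
Proof. by move=> s; apply/asboolP; apply: tens_rel_refl. Qed.
Fact tens_relb_sym : symmetric tens_relb.
Proof.
move=> s t; apply/idP/idP => /asboolP st; apply/asboolP;
  exact: tens_rel_sym st.
Qed.
Fact tens_relb_trans : transitive tens_relb.
Proof.
move=> t s u /asboolP st /asboolP tu; apply/asboolP.
exact: tens_rel_trans st tu.
Qed.

Canonical tens_equiv :=
  EquivRel tens_relb tens_relb_refl tens_relb_sym tens_relb_trans.

Definition tens : Type := {eq_quot tens_equiv}.
HB.instance Definition _ := Choice.on tens.
HB.instance Definition _ := EqQuotient.on tens.

Implicit Types (s t : seq (M * N)) (u v w : tens).

Lemma tens_eqP s t : \pi_tens s = \pi_tens t <-> tens_rel s t.
Proof. by split=> [/eqquotP/asboolP | ?]; last apply/eqquotP/asboolP. Qed.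

Definition elem (x : M) (y : N) : tens := \pi_tens [:: (x, y)].

Definition tens0 : tens := \pi_tens [::].
Definition tens_add u v : tens := \pi_tens (repr u ++ repr v).
Definition tens_opp u : tens := \pi_tens [seq (- p.1, p.2) | p <- repr u].

Lemma tens_pi_repr s : tens_rel (repr (\pi_tens s)) s.
Proof. by apply/tens_eqP; rewrite reprK. Qed.

Lemma tens_addE s t : tens_add (\pi_tens s) (\pi_tens t) = \pi_tens (s ++ t).
Proof. by apply/tens_eqP; apply: tens_rel_cat; apply: tens_pi_repr. Qed.

Fact tens_addA : associative tens_add.
Proof.
move=> u v w; rewrite -[u]reprK -[v]reprK -[w]reprK.
by rewrite (tens_addE (repr v)) (tens_addE (repr u) (repr v)) !tens_addE catA.
Qed.
Fact tens_addC : commutative tens_add.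
Proof.
move=> u v; rewrite -[u]reprK -[v]reprK !tens_addE.
by apply/tens_eqP; apply: tens_rel_catC.
Qed.
Fact tens_add0 : left_id tens0 tens_add.
Proof. by move=> u; rewrite -[u]reprK tens_addE. Qed.
Fact tens_addN : left_inverse tens0 tens_opp tens_add.
Proof.
move=> u; rewrite -[u in tens_add _ u]reprK tens_addE; apply/tens_eqP.
elim: (repr u) => [|[x y] s IHs] /=; first exact: tens_rel_refl.
set s' := [seq _ | _ <- s] in IHs *.
apply: tens_rel_trans (_ : tens_rel ([:: (- x, y); (x, y)] ++ (s' ++ s)) _).
  have -> : (- x, y) :: s' ++ (x, y) :: s
          = [:: (- x, y)] ++ ((s' ++ [:: (x, y)]) ++ s) by rewrite -catA.
  have -> : [:: (- x, y); (x, y)] ++ s' ++ s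
          = [:: (- x, y)] ++ (([:: (x, y)] ++ s') ++ s) by [].
  apply: tens_rel_cat; first exact: tens_rel_refl.
  by apply: tens_rel_cat; [apply: tens_rel_catC | apply: tens_rel_refl].
rewrite -[[::]]/([::] ++ [::]); apply: tens_rel_cat => //.
apply: tens_rel_trans (tens_rel_0l y).
by rewrite -(addNr x); apply: tens_rel_sym; apply: tens_rel_Dl.
Qed.

HB.instance Definition _ :=
  GRing.isZmodule.Build tens tens_addA tens_addC tens_add0 tens_addN.

Lemma pi_cat s t : \pi_tens (s ++ t) = \pi_tens s + \pi_tens t :> tens.
Proof. by rewrite -tens_addE. Qed.

Lemma elemDl x x' y : elem (x + x') y = elem x y + elem x' y.
Proof. by rewrite -pi_cat; apply/tens_eqP; apply: tens_rel_Dl. Qed.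
Lemma elemDr x y y' : elem x (y + y') = elem x y + elem x y'.
Proof. by rewrite -pi_cat; apply/tens_eqP; apply: tens_rel_Dr. Qed.
Lemma elemZ a x y : elem (a *: x) y = elem x (a *: y).
Proof. by apply/tens_eqP; apply: tens_rel_Z. Qed.

Lemma pi_sum s : \pi_tens s = \sum_(p <- s) elem p.1 p.2 :> tens.
Proof.
elim: s => [|[x y] s IHs]; first by rewrite big_nil.
by rewrite big_cons -IHs -pi_cat.
Qed.

Lemma tens_ind (P : tens -> Prop) :
  P 0 -> (forall x y, P (elem x y)) -> (forall u v, P u -> P v -> P (u + v)) ->
  forall u, P u.
Proof.
move=> P0 Pe PD; move=> u; rewrite -[u]reprK pi_sum.
by elim/big_ind: _ => // i _.
Qed.

Definition balanced (A : zmodType) (f : M -> N -> A) : Prop :=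
  [/\ forall x x' y, f (x + x') y = f x y + f x' y,
      forall x y y', f x (y + y') = f x y + f x y'
    & forall a x y, f (a *: x) y = f x (a *: y)].

Definition tens_lift (A : zmodType) (f : M -> N -> A) (u : tens) : A :=
  \sum_(p <- repr u) f p.1 p.2.

Section Lift.
Variables (A : zmodType) (f : M -> N -> A).
Hypothesis f_bal : balanced f.

Lemma tens_lift_pi s : tens_lift f (\pi_tens s) = \sum_(p <- s) f p.1 p.2.
Proof.
have [fDl fDr fZ] := f_bal; rewrite /tens_lift.
have sum_rel s1 s2 : tens_rel s1 s2 ->
    \sum_(p <- s1) f p.1 p.2 = \sum_(p <- s2) f p.1 p.2; last first.
  exact/sum_rel/tens_pi_repr.
elim=> {s1 s2} //=.
- by move=> s1 s2 s3 _ -> _ ->.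
- by move=> s1 s1' s2 s2' _ E1 _ E2; rewrite !big_cat /= E1 E2.
- by move=> s1 s2; rewrite !big_cat /= addrC.
- move=> y; rewrite big_seq1 big_nil /=.
  by apply: (addrI (f 0 y)); rewrite -fDl !addr0.
- by move=> *; rewrite !big_cons !big_nil /= !addr0.
- by move=> *; rewrite !big_cons !big_nil /= !addr0.
- by move=> *; rewrite !big_seq1 /=.
Qed.

Lemma tens_liftE x y : tens_lift f (elem x y) = f x y.
Proof. by rewrite tens_lift_pi big_seq1. Qed.
Lemma tens_lift0 : tens_lift f 0 = 0.
Proof. by rewrite -[0]/(\pi_tens [::]) tens_lift_pi big_nil. Qed.
Lemma tens_liftD u v : tens_lift f (u + v) = tens_lift f u + tens_lift f v.
Proof.
by rewrite -[u]reprK -[v]reprK -pi_cat !tens_lift_pi big_cat.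
Qed.
End Lift.

Definition tens_scale (a : Q) : tens -> tens :=
  tens_lift (fun x y => elem (a *: x) y).

Fact tens_scale_balanced a : balanced (fun x y => elem (a *: x) y).
Proof.
split=> [x x' y|x y y'|b x y]; first by rewrite scalerDr elemDl.
  exact: elemDr.
by rewrite -elemZ !scalerA mulrC.
Qed.

Lemma tens_scaleE a x y : tens_scale a (elem x y) = elem (a *: x) y.
Proof. exact: tens_liftE (tens_scale_balanced a) _ _. Qed.

Fact tens_scalerDr : right_distributive tens_scale +%R.
Proof. by move=> a u v; apply: tens_liftD; apply: tens_scale_balanced. Qed.
Fact tens_scale_0 a : tens_scale a 0 = 0.
Proof. by apply: tens_lift0; apply: tens_scale_balanced. Qed.
Fact tens_scalerA a b u : tens_scale a (tens_scale b u) = tens_scale (a * b) u.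
Proof.
elim/tens_ind: u => [|x y|u v IHu IHv]; first by rewrite !tens_scale_0.
  by rewrite !tens_scaleE scalerA.
by rewrite !tens_scalerDr IHu IHv.
Qed.
Fact tens_scale1r : left_id 1 tens_scale.
Proof.
elim/tens_ind=> [|x y|u v IHu IHv]; first by rewrite tens_scale_0.
  by rewrite tens_scaleE scale1r.
by rewrite tens_scalerDr IHu IHv.
Qed.
Fact tens_scalerDl u : {morph tens_scale^~ u : a b / a + b}.
Proof.
move=> a b; elim/tens_ind: u => [|x y|u v IHu IHv].
- by rewrite !tens_scale_0 addr0.
- by rewrite !tens_scaleE scalerDl elemDl.
- by rewrite !tens_scalerDr IHu IHv addrACA.
Qed.

HB.instance Definition _ := GRing.Zmodule_isLmodule.Build Q tens
  tens_scalerA tens_scale1r tens_scalerDr tens_scalerDl.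

End Tensor.

Definition tens_map (Q : comPzRingType) (M M' N N' : lmodType Q)
    (f : {linear M -> M'}) (g : {linear N -> N'}) : tens M N -> tens M' N' :=
  tens_lift (fun x y => elem (f x) (g y)).

Lemma tens_mapE (Q : comPzRingType) (M M' N N' : lmodType Q)
    (f : {linear M -> M'}) (g : {linear N -> N'}) x y :
  tens_map f g (elem x y) = elem (f x) (g y).
Proof.
apply: tens_liftE; split=> [? ? ?|? ? ?|? ? ?].
- by rewrite linearD elemDl.
- by rewrite linearD elemDr.
- by rewrite !linearZ elemZ.
Qed.

Definition flat (Q : comPzRingType) (N : lmodType Q) : Prop :=
  forall (U V : lmodType Q) (f : {linear U -> V}),
    injective f -> injective (tens_map f (idfun : {linear N -> N})).

(* The (R,R)-bimodule E (x)_Q R; an alias of tens E (alg_mod R), whose own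
   module structure is over Q. *)
Definition tens_alg (Q : comPzRingType) (E : lmodType Q) (R : pzAlgType Q) :
  Type := tens E (alg_mod R).

Section TensAlg.
Variables (Q : comPzRingType) (E : lmodType Q) (R : pzAlgType Q).

HB.instance Definition _ := GRing.Zmodule.on (tens_alg E R).

Definition tens_alg_lscale (r : R) : tens_alg E R -> tens_alg E R :=
  tens_lift (fun (x : E) (y : alg_mod R) => elem x (r * (y : R) : alg_mod R)).
Definition tens_alg_rscale (u : tens_alg E R) (r : R) : tens_alg E R :=
  tens_lift (fun (x : E) (y : alg_mod R) => elem x ((y : R) * r : alg_mod R)) u.

Local Notation lsc := tens_alg_lscale.
Local Notation rsc := tens_alg_rscale.

Fact tens_alg_lscale_balanced r :
  balanced (fun (x : E) (y : alg_mod R) => elem x (r * (y : R) : alg_mod R)).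
Proof.
split=> [x x' y|x y y'|b x y]; first exact: elemDl.
  by rewrite mulrDr elemDr.
by rewrite elemZ; congr elem; apply: ascalerAr.
Qed.
Fact tens_alg_rscale_balanced r :
  balanced (fun (x : E) (y : alg_mod R) => elem x ((y : R) * r : alg_mod R)).
Proof.
split=> [x x' y|x y y'|b x y]; first exact: elemDl.
  by rewrite mulrDl elemDr.
by rewrite elemZ; congr elem; apply: ascalerAl.
Qed.

Lemma tens_alg_lscaleE (r : R) (x : E) (y : R) :
  lsc r (elem x (y : alg_mod R)) = elem x (r * y : alg_mod R).
Proof. exact: tens_liftE (tens_alg_lscale_balanced r) _ _. Qed.
Lemma tens_alg_rscaleE (x : E) (y r : R) :
  rsc (elem x (y : alg_mod R)) r = elem x (y * r : alg_mod R).
Proof. exact: tens_liftE (tens_alg_rscale_balanced r) _ _. Qed.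

Fact tens_alg_scalerDr : right_distributive lsc +%R.
Proof. by move=> a u v; apply: tens_liftD (tens_alg_lscale_balanced a) _ _. Qed.
Fact tens_alg_lscale0 r : lsc r 0 = 0.
Proof. exact: tens_lift0 (tens_alg_lscale_balanced r). Qed.
Fact tens_alg_rscalerDl r u v : rsc (u + v) r = rsc u r + rsc v r.
Proof. exact: tens_liftD (tens_alg_rscale_balanced r) _ _. Qed.
Fact tens_alg_rscale0 r : rsc 0 r = 0.
Proof. exact: tens_lift0 (tens_alg_rscale_balanced r). Qed.

Fact tens_alg_scalerA a b u : lsc a (lsc b u) = lsc (a * b) u.
Proof.
elim/tens_ind: u => [|x y|u v IHu IHv]; first by rewrite !tens_alg_lscale0.
  by rewrite !tens_alg_lscaleE mulrA.
by rewrite !tens_alg_scalerDr IHu IHv.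
Qed.
Fact tens_alg_scale1r : left_id 1 lsc.
Proof.
elim/tens_ind=> [|x y|u v IHu IHv]; first by rewrite tens_alg_lscale0.
  by rewrite tens_alg_lscaleE mul1r.
by rewrite tens_alg_scalerDr IHu IHv.
Qed.
Fact tens_alg_scalerDl u : {morph lsc^~ u : a b / a + b}.
Proof.
move=> a b; elim/tens_ind: u => [|x y|u v IHu IHv].
- by rewrite !tens_alg_lscale0 addr0.
- by rewrite !tens_alg_lscaleE mulrDl elemDr.
- by rewrite !tens_alg_scalerDr IHu IHv addrACA.
Qed.

HB.instance Definition _ := GRing.Zmodule_isLmodule.Build R (tens_alg E R)
  tens_alg_scalerA tens_alg_scale1r tens_alg_scalerDr tens_alg_scalerDl.

Fact tens_alg_rscalerA u r r' : rsc (rsc u r) r' = rsc u (r * r').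
Proof.
elim/tens_ind: u => [|x y|u v IHu IHv]; first by rewrite !tens_alg_rscale0.
  by rewrite !tens_alg_rscaleE mulrA.
by rewrite !tens_alg_rscalerDl IHu IHv.
Qed.
Fact tens_alg_rscaler1 u : rsc u 1 = u.
Proof.
elim/tens_ind: u => [|x y|u v IHu IHv]; first by rewrite tens_alg_rscale0.
  by rewrite tens_alg_rscaleE mulr1.
by rewrite tens_alg_rscalerDl IHu IHv.
Qed.
Fact tens_alg_rscalerDr u r r' : rsc u (r + r') = rsc u r + rsc u r'.
Proof.
elim/tens_ind: u => [|x y|u v IHu IHv].
- by rewrite !tens_alg_rscale0 addr0.
- by rewrite !tens_alg_rscaleE mulrDr elemDr.
- by rewrite !tens_alg_rscalerDl IHu IHv addrACA.
Qed.
Fact tens_alg_scale_rscale (s : R) (u : tens_alg E R) r :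
  s *: rsc u r = rsc (s *: u) r.
Proof.
change (lsc s (rsc u r) = rsc (lsc s u) r).
elim/tens_ind: u => [|x y|u v IHu IHv].
- by rewrite tens_alg_lscale0 tens_alg_rscale0 tens_alg_lscale0.
- by rewrite tens_alg_lscaleE !tens_alg_rscaleE tens_alg_lscaleE mulrA.
- by rewrite tens_alg_scalerDr !tens_alg_rscalerDl tens_alg_scalerDr IHu IHv.
Qed.

HB.instance Definition _ := Lmodule_isBimodule.Build R R (tens_alg E R)
  tens_alg_rscalerA tens_alg_rscaler1 tens_alg_rscalerDl tens_alg_rscalerDr
  tens_alg_scale_rscale.

End TensAlg.

Definition projective (S : pzRingType) (P : lmodType S) : Prop :=
  forall (U V : lmodType S) (g : {linear U -> V}) (f : {linear P -> V}),
    (forall v, exists u, g u = v) -> exists h : {linear P -> U}, g \o h =1 f.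

Definition fin_generated (S : pzRingType) (P : lmodType S) : Prop :=
  exists (n : nat) (e : 'I_n -> P),
    forall x, exists a : 'I_n -> S, x = \sum_(i < n) a i *: e i.

Record proj_resolution (S : pzRingType) (M : lmodType S) := ProjResolution {
  res_mod :> nat -> lmodType S;
  res_diff : forall n, {linear res_mod n.+1 -> res_mod n};
  res_aug : {linear res_mod 0 -> M};
  res_projective : forall n, projective (res_mod n);
  res_aug_surj : forall x, exists y, res_aug y = x;
  res_exact0 : forall y, res_aug y = 0 <-> exists z, res_diff 0 z = y;
  res_exact : forall n y,
    res_diff n y = 0 <-> exists z, res_diff n.+1 z = y
}.

Definition has_degreewise_finite_resolution (S : pzRingType) (M : lmodType S) :
  Prop := exists P : proj_resolution M, forall n, fin_generated (P n).

Section Ext.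
Variables (S : pzRingType) (M N : lmodType S) (P : proj_resolution M).

Definition cocycle (i : nat) (f : {linear P i -> N}) : Prop :=
  f \o res_diff P i =1 \0.

Definition coboundary (i : nat) : {linear P i -> N} -> Prop :=
  match i return {linear P i -> N} -> Prop with
  | 0 => fun f => f =1 \0
  | j.+1 => fun f => exists g : {linear P j -> N}, g \o res_diff P j =1 f
  end.
End Ext.

(* Ext_S^i(M, N) = 0, where Ext_S^i(M, N) is the i-th cohomology of the complex
   Hom_S(P, N) for a projective resolution P of M. Resolutions always exist and
   the cohomology does not depend on P, so all of them are quantified over. *)
Definition Ext_vanishes (S : pzRingType) (i : nat) (M N : lmodType S) : Prop :=
  forall (P : proj_resolution M) (f : {linear P i -> N}),
    cocycle f -> coboundary f.

(* Homothety maps are always ring homomorphisms (into the opposite endomorphism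
   ring for right_homothety), so being an isomorphism is being bijective. *)
Definition homothety (Q : comPzRingType) (E : lmodType Q) (a : Q) :
  {linear E -> E} := *:%R a.

Record semidualizing_module (Q : comPzRingType) (E : lmodType Q) : Prop := {
  sdm_resolution : has_degreewise_finite_resolution E;
  sdm_homothety : bijective (@homothety Q E);
  sdm_ext : forall i, (1 <= i)%N -> Ext_vanishes i E E
}.

Record semidualizing (S R : pzRingType) (C : bimodType S R) : Prop := {
  sd_a1 : has_degreewise_finite_resolution (C : lmodType S);
  sd_a2 : has_degreewise_finite_resolution (right_mod C : lmodType R^c);
  sd_b1 : bijective (@left_homothety S R C);
  sd_b2 : bijective (@right_homothety S R C);
  sd_c1 : forall i, (1 <= i)%N ->
    Ext_vanishes i (C : lmodType S) (C : lmodType S);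
  sd_c2 : forall i, (1 <= i)%N ->
    Ext_vanishes i (right_mod C : lmodType R^c) (right_mod C : lmodType R^c)
}.

Record faithfully_semidualizing (S R : pzRingType) (C : bimodType S R) :
    Prop := {
  fsd_semidualizing : semidualizing C;
  fsd_left : forall N : lmodType S,
    (forall f : {linear C -> N}, f =1 \0) -> forall x : N, x = 0;
  fsd_right : forall M : lmodType R^c,
    (forall f : {linear right_mod C -> M}, f =1 \0) -> forall x : M, x = 0
}.

(* Main.v *)
From HB Require Import structures.
Require Import Defs.
From mathcomp Require Import all_boot all_algebra.
From mathcomp Require Import boolp.

(* Let P be a resolution of E by finitely generated projectives. As R is flat,
   P (x) R is such a resolution of C = E (x) R over R, and
   Hom_R(P (x) R, C) = Hom_Q(P, C) = Hom_Q(P, E) (x) R. Flatness again shows that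
   its cohomology is Ext_Q(E, E) (x) R, that is, Q (x) R = R in degree 0 and 0 in
   the other degrees. For faithfulness, Hom_R(C, N) = Hom_Q(E, N), and this is
   nonzero for N <> 0 because E is finitely generated and faithful over the
   commutative ring Q. The statements about C as a right module follow from
   those about left modules, applied to the Q-algebra R^op. *)

Set Implicit Arguments.
Unset Strict Implicit.
Unset Printing Implicit Defensive.

Import GRing.Theory.
Local Open Scope ring_scope.
Local Open Scope quotient_scope.

(** * Linear maps and projective modules *)

Section LinearRange.
Variables (S : pzRingType) (V W : lmodType S) (g : {linear V -> W}).

Definition lrange : {pred W} := fun w => `[< exists v, g v = w >].

Fact lrange_submod_closed : submod_closed lrange.
Proof.
split=> [|a u v]; first by apply/asboolP; exists 0; rewrite linear0.
move=> /asboolP[x <-] /asboolP[y <-]; apply/asboolP.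
by exists (a *: x + y); rewrite linearP.
Qed.
HB.instance Definition _ :=
  GRing.isSubmodClosed.Build S W lrange lrange_submod_closed.

(** The image as a module of its own: [g] is the surjection [lrange_cor] followed by the injection
    [lrange_val]. *)
Record lrange_mod := LrangeMod { lrange_val :> W; _ : lrange_val \in lrange }.
HB.instance Definition _ := [isSub for lrange_val].
HB.instance Definition _ := [Choice of lrange_mod by <:].
HB.instance Definition _ := [SubChoice_isSubLmodule of lrange_mod by <:].

Fact lrange_cor_subproof v : g v \in lrange.
Proof. by apply/asboolP; exists v. Qed.
Definition lrange_cor (v : V) : lrange_mod := LrangeMod (lrange_cor_subproof v).

Fact lrange_cor_linear : linear lrange_cor.
Proof. by move=> a x y; apply: val_inj; rewrite /= linearP. Qed.
HB.instance Definition _ :=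
  GRing.isLinear.Build S V lrange_mod _ lrange_cor lrange_cor_linear.

Lemma lrange_corP (w : lrange_mod) : exists v, lrange_cor v = w.
Proof.
by case: w => w gw; have /asboolP[v gv] := gw; exists v; apply: val_inj.
Qed.

Fact lrange_val_linear : linear lrange_val.
Proof. by []. Qed.
HB.instance Definition _ :=
  GRing.isLinear.Build S lrange_mod W _ lrange_val lrange_val_linear.
End LinearRange.

Section Projective.
Variable S : pzRingType.
Implicit Types (P U V W : lmodType S).

(** Projectivity is applied to the corestriction of [g] to its image. This form serves to lift along
    differentials, which are rarely surjective. *)
Lemma projective_lift P U V (g : {linear U -> V}) (f : {linear P -> V}) :
  projective P -> (forall p, exists u, g u = f p) ->
  exists h : {linear P -> U}, g \o h =1 f.
Proof.
move=> projP gf.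
have fP p : f p \in lrange g by apply/asboolP.
pose f' p : lrange_mod g := LrangeMod (fP p).
have f'_lin : linear f' by move=> a x y; apply: val_inj; rewrite /= linearP.
pose f'L := GRing.isLinear.Build S P (lrange_mod g) _ f' f'_lin.
pose F : {linear P -> lrange_mod g} := HB.pack f' f'L.
have [h hF] := projP _ _ (lrange_cor g : {linear _ -> _}) F (@lrange_corP _ _ _ g).
by exists h => p; have /(congr1 val) := hF p.
Qed.

Lemma linear_build U V (f : U -> V) :
  linear f -> exists F : {linear U -> V}, F =1 f.
Proof.
move=> f_lin; pose fL := GRing.isLinear.Build S U V _ f f_lin.
by exists (HB.pack f fL : {linear U -> V}).
Qed.

(** The section [s] of [e] need not be linear, but [f \o s] is, since [f] does not see the choice of
    preimages. *)
Lemma linear_factor P U V (e : {linear P -> U}) (f : {linear P -> V}) :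
  (forall u, exists p, e p = u) -> (forall p, e p = 0 -> f p = 0) ->
  exists h : {linear U -> V}, h \o e =1 f.
Proof.
move=> /choice[s sK] fe.
have fs p : f (s (e p)) = f p.
  by apply/eqP; rewrite -subr_eq0 -linearB fe // linearB sK subrr.
have [|h hE] := @linear_build U V (f \o s).
  by move=> a x y; rewrite -{1}[x]sK -{1}[y]sK -linearP /= fs linearP.
by exists h => p /=; rewrite hE /= fs.
Qed.

(** The data of the dual basis lemma, whose existence amounts to [P] being finitely generated and
    projective. *)
Definition dual_basis P n (e : 'I_n -> P) (c : 'I_n -> P -> S) : Prop :=
  (forall i a x y, c i (a *: x + y) = a * c i x + c i y) /\
  (forall x, x = \sum_(i < n) c i x *: e i).

Section DualBasisTheory.
Variables (P : lmodType S) (n : nat) (e : 'I_n -> P) (c : 'I_n -> P -> S).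
Hypothesis ec : dual_basis e c.

Lemma dual_basis0 i : c i 0 = 0.
Proof.
by have := ec.1 i (-1) 0 0; rewrite scaler0 add0r mulN1r addNr.
Qed.

Lemma dual_basisD i x y : c i (x + y) = c i x + c i y.
Proof. by have := ec.1 i 1 x y; rewrite scale1r mul1r. Qed.

Lemma dual_basisZ i a x : c i (a *: x) = a * c i x.
Proof. by have := ec.1 i a x 0; rewrite dual_basis0 !addr0. Qed.

Lemma dual_basis_lincomb i k (a : 'I_k -> S) (y : 'I_k -> P) :
  c i (\sum_l a l *: y l) = \sum_l a l * c i (y l).
Proof.
elim/big_rec2: _ => [|l z u _ <-]; first exact: dual_basis0.
by rewrite dual_basisD dual_basisZ.
Qed.
End DualBasisTheory.

Definition lincomb P n (e : 'I_n -> P) (a : 'rV[S]_n) : P :=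
  \sum_(i < n) a 0 i *: e i.

Fact lincomb_linear P n (e : 'I_n -> P) : linear (lincomb e).
Proof.
move=> a x y; rewrite /lincomb scaler_sumr -big_split; apply: eq_bigr => i _ /=.
by rewrite !mxE scalerDl scalerA.
Qed.
HB.instance Definition _ P n (e : 'I_n -> P) :=
  GRing.isLinear.Build S 'rV[S]_n P _ (lincomb e) (lincomb_linear e).

(** The [c i] are the coordinates of a splitting of the surjection from row vectors onto [P]. *)
Lemma fg_projective_dual_basis P :
  projective P -> fin_generated P -> exists n (e : 'I_n -> P) c, dual_basis e c.
Proof.
move=> projP [n [e eP]].
have [|h hK] := projP _ _ (lincomb e : {linear _ -> _}) (idfun : {linear P -> P}).
  move=> x; have [a ->] := eP x; exists (\row_i a i).
  by apply: eq_bigr => i _; rewrite mxE.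
exists n, e, (fun i x => h x 0 i); split=> [i a x y|x].
  by rewrite linearP !mxE.
by have := hK x => /= /esym.
Qed.

Lemma dual_basis_projective P n (e : 'I_n -> P) c :
  dual_basis e c -> projective P /\ fin_generated P.
Proof.
move=> [c_lin cK]; split=> [U V g f g_surj|]; last first.
  by exists n, e => x; exists (c^~ x).
have [u uP] := choice (fun i : 'I_n => g_surj (f (e i))).
have [|h hE] := @linear_build P U (fun x => \sum_(i < n) c i x *: u i).
  move=> a x y; rewrite scaler_sumr -big_split; apply: eq_bigr => i _ /=.
  by rewrite c_lin scalerDl scalerA.
exists h => x /=; rewrite hE linear_sum [in RHS](cK x) linear_sum.
by apply: eq_bigr => i _; rewrite !linearZ /= uP.
Qed.

End Projective.

(** * Tensor products with flat modules *)

Section TensorTheory.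
Variable Q : comPzRingType.
Implicit Types (M N P E U V W : lmodType Q).

Lemma elem0l M N (y : N) : elem (0 : M) y = 0.
Proof. by apply: (addrI (elem (0 : M) y)); rewrite -elemDl !addr0. Qed.

Lemma elem0r M N (x : M) : elem x (0 : N) = 0.
Proof. by apply: (addrI (elem x (0 : N))); rewrite -elemDr !addr0. Qed.

Lemma elemBl M N (x x' : M) (y : N) : elem (x - x') y = elem x y - elem x' y.
Proof. by apply: (addIr (elem x' y)); rewrite -elemDl !subrK. Qed.

Lemma elem_suml M N n (f : 'I_n -> M) (y : N) :
  elem (\sum_i f i) y = \sum_i elem (f i) y.
Proof.
by elim/big_rec2: _ => [|i u v _ <-]; rewrite ?elem0l ?elemDl.
Qed.

Lemma tens_scaleZ M N a (x : M) (y : N) : a *: elem x y = elem (a *: x) y.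
Proof. exact: tens_scaleE. Qed.

Lemma tens_sumP M N (w : tens M N) :
  exists s : seq (M * N), w = \sum_(p <- s) elem p.1 p.2.
Proof. by exists (repr w); rewrite -pi_sum reprK. Qed.

Lemma tens_lift_linear M N U (f : M -> N -> U) :
  balanced f -> (forall a x y, f (a *: x) y = a *: f x y) ->
  linear (tens_lift f).
Proof.
move=> f_bal fZ a u v; rewrite tens_liftD //; congr (_ + _).
elim/tens_ind: u => [|x y|u u' IHu IHu'].
- by rewrite scaler0 tens_lift0 // scaler0.
- by rewrite tens_scaleZ !tens_liftE.
- by rewrite scalerDr !tens_liftD // IHu IHu' scalerDr.
Qed.

Section TensMap.
Variables (M M' N N' : lmodType Q) (f : {linear M -> M'}) (g : {linear N -> N'}).

Fact tens_map_balanced : balanced (fun x y => elem (f x) (g y)).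
Proof.
split=> [? ? ?|? ? ?|? ? ?]; first by rewrite linearD elemDl.
  by rewrite linearD elemDr.
by rewrite !linearZ elemZ.
Qed.

Fact tens_map_linear : linear (tens_map f g).
Proof.
apply: tens_lift_linear => [|a x y]; first exact: tens_map_balanced.
by rewrite linearZ tens_scaleZ.
Qed.
HB.instance Definition _ :=
  GRing.isLinear.Build Q (tens M N) (tens M' N') _ (tens_map f g) tens_map_linear.

Lemma tens_map_sum (s : seq (M * N)) :
  tens_map f g (\sum_(p <- s) elem p.1 p.2) =
  \sum_(p <- s) elem (f p.1) (g p.2).
Proof. by rewrite linear_sum; apply: eq_bigr => p _; rewrite /= tens_mapE. Qed.
End TensMap.

Lemma tens_map_comp M M' M'' N N' N'' (f : {linear M -> M'})
    (f' : {linear M' -> M''}) (g : {linear N -> N'}) (g' : {linear N' -> N''}) u :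
  tens_map f' g' (tens_map f g u) =
  tens_map (f' \o f : {linear M -> M''}) (g' \o g : {linear N -> N''}) u.
Proof.
elim/tens_ind: u => [|x y|u v IHu IHv]; first by rewrite !linear0.
  by rewrite !tens_mapE.
by rewrite !linearD /= IHu IHv.
Qed.

Lemma eq_tens_map M M' N N' (f f' : {linear M -> M'}) (g g' : {linear N -> N'}) :
  f =1 f' -> g =1 g' -> tens_map f g =1 tens_map f' g'.
Proof.
move=> ff gg; elim/tens_ind=> [|x y|u v IHu IHv]; first by rewrite !linear0.
  by rewrite !tens_mapE ff gg.
by rewrite !linearD /= IHu IHv.
Qed.

Lemma tens_map_id M N u :
  tens_map (idfun : {linear M -> M}) (idfun : {linear N -> N}) u = u.
Proof.
elim/tens_ind: u => [|x y|u v IHu IHv]; first by rewrite !linear0.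
  by rewrite !tens_mapE.
by rewrite !linearD /= IHu IHv.
Qed.

(* A choice of preimages under g is Q-linear up to the kernel of g, so the
   congruence generating the tensor product lifts along it. *)
Lemma tens_ker_surj V U N (g : {linear V -> U}) (w : tens V N) :
  (forall u, exists v, g v = u) -> tens_map g (idfun : {linear N -> N}) w = 0 ->
  exists2 s : seq (V * N), w = \sum_(p <- s) elem p.1 p.2 &
    forall p, p \in s -> g p.1 = 0.
Proof.
move=> /choice[sg sgK].
pose K (z : tens V N) := exists2 s : seq (V * N),
  z = \sum_(p <- s) elem p.1 p.2 & forall p, p \in s -> g p.1 = 0.
have K0 : K 0 by exists [::]; rewrite ?big_nil.
have KD z z' : K z -> K z' -> K (z + z').
  move=> [s -> gs] [s' -> gs']; exists (s ++ s'); rewrite ?big_cat // => p.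
  by rewrite mem_cat => /orP[/gs | /gs'].
have Ke v n : g v = 0 -> K (elem v n).
  by move=> gv; exists [:: (v, n)]; rewrite ?big_seq1 // => p /[!inE] /eqP->.
have KN z : K z -> K (- z).
  move=> [s -> gs]; exists [seq (- p.1, p.2) | p <- s].
    rewrite -sumrN big_map; apply: eq_bigr => -[x y] _ /=.
    by rewrite -[- x]add0r elemBl elem0l add0r.
  by move=> p /mapP[q sq ->]; rewrite linearN gs ?oppr0.
(* [sg] is not linear, so the lift is defined on formal sums only; [lift_rel] shows that it is well
   defined modulo [K]. *)
pose lift (s : seq (U * N)) := \sum_(p <- s) elem (sg p.1) p.2 : tens V N.
have lift_rel s t : tens_rel s t -> K (lift s - lift t).
  elim=> {s t} [s|s t _|s t u _ Kst _|s s' t t' _ Ks _ Kt|s t|y|x x' y|x y y'|a x y].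
  - by rewrite subrr.
  - by move/KN; rewrite opprB.
  - by move/(KD _ _ Kst); rewrite addrA subrK.
  - by rewrite /lift !big_cat /= opprD addrACA; apply: KD.
  - by rewrite /lift !big_cat /= [X in _ - X]addrC subrr.
  - by rewrite /lift big_seq1 big_nil subr0; apply: Ke.
  - rewrite /lift !big_cons !big_nil /= !addr0 opprD addrA -!elemBl.
    by apply: Ke; rewrite !linearB !sgK /= addrAC addrK subrr.
  - by rewrite /lift !big_cons !big_nil /= !addr0 elemDr subrr.
  - rewrite /lift !big_seq1 /= -elemZ -elemBl.
    by apply: Ke; rewrite linearB linearZ /= !sgK subrr.
have [s ->] := tens_sumP w; rewrite tens_map_sum.
have -> : \sum_(p <- s) elem (g p.1) p.2 = \sum_(p <- [seq (g p.1, p.2) | p <- s])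
    elem p.1 p.2 by rewrite big_map.
rewrite -(pi_sum [seq _ | _ <- s]) => gw; have {gw} := lift_rel _ _ ((tens_eqP _ [::]).1 gw).
rewrite /lift big_nil subr0 big_map => /= Ks; change (K (\sum_(p <- s) elem p.1 p.2)).
(* The given tensor minus the lift of its image is a sum of terms [elem (p.1 - sg (g p.1)) p.2],
   with first factors in the kernel. *)
rewrite -[X in K X](subrK (\sum_(p <- s) elem (sg (g p.1)) p.2)).
apply: (KD _ _ _ Ks); rewrite -sumrB; apply: (big_ind K K0 KD) => p _.
by rewrite -elemBl; apply: Ke; rewrite linearB sgK subrr.
Qed.

(** Flatness keeps the inclusion of the image of [g] injective after tensoring, which leaves the
    surjective case. *)
Lemma tens_ker V W N (g : {linear V -> W}) (w : tens V N) :
  flat N -> tens_map g (idfun : {linear N -> N}) w = 0 ->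
  exists2 s : seq (V * N), w = \sum_(p <- s) elem p.1 p.2 &
    forall p, p \in s -> g p.1 = 0.
Proof.
move=> flatN gw; pose g' : {linear V -> lrange_mod g} := lrange_cor g.
pose j : {linear lrange_mod g -> W} := @lrange_val _ _ _ g.
have [||s -> gs] := @tens_ker_surj _ _ N g' w; first exact: lrange_corP.
  apply: (flatN _ _ j); first exact: val_inj.
  rewrite linear0 tens_map_comp -[RHS]gw; exact: eq_tens_map.
by exists s => // p /gs/(congr1 val).
Qed.

Section FfunTensor.
Variables (T : finType) (E N : lmodType Q).

Definition ffun_proj (t : T) (v : {ffun T -> E}) : E := v t.
Fact ffun_proj_linear t : linear (ffun_proj t).
Proof. by move=> a u v; rewrite /ffun_proj !ffunE. Qed.
HB.instance Definition _ t := GRing.isLinear.Build Q {ffun T -> E} E _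
  (ffun_proj t) (ffun_proj_linear t).

Definition ffun_inj (t : T) (x : E) : {ffun T -> E} :=
  [ffun t' => if t' == t then x else 0].
Fact ffun_inj_linear t : linear (ffun_inj t).
Proof.
by move=> a u v; apply/ffunP=> t'; rewrite !ffunE; case: eqP; rewrite ?scaler0 ?addr0.
Qed.
HB.instance Definition _ t := GRing.isLinear.Build Q E {ffun T -> E} _
  (ffun_inj t) (ffun_inj_linear t).

Let pr t := tens_map (ffun_proj t : {linear _ -> _}) (idfun : {linear N -> N}).
Let inj t := tens_map (ffun_inj t : {linear _ -> _}) (idfun : {linear N -> N}).

Lemma tens_ffun_sum (w : tens {ffun T -> E} N) : w = \sum_t inj t (pr t w).
Proof.
elim/tens_ind: w => [|v y|u v IHu IHv].
- by rewrite big1 // => t _; rewrite /inj /pr !linear0.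
- rewrite (eq_bigr (fun t => elem (ffun_inj t (v t)) y)); last first.
    by move=> t _; rewrite /inj /pr !tens_mapE.
  have -> : v = \sum_t ffun_inj t (v t).
    apply/ffunP=> t; rewrite sum_ffunE (bigD1 t) //= !ffunE eqxx.
    by rewrite big1 ?addr0 // => t' /negPf nt; rewrite !ffunE eq_sym nt.
  elim/big_rec2: _ => [|t w w' _ <-]; first by rewrite elem0l.
  rewrite elemDl; congr (elem (ffun_inj _ _) _ + _).
  rewrite sum_ffunE (bigD1 t) //= !ffunE eqxx.
  by rewrite big1 ?addr0 // => t' /negPf nt; rewrite !ffunE eq_sym nt.
- rewrite {1}IHu {1}IHv -big_split; apply: eq_bigr => t _ /=.
  by rewrite /inj /pr !linearD.
Qed.

Lemma tens_ffun_eq0 (w : tens {ffun T -> E} N) : (forall t, pr t w = 0) -> w = 0.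
Proof.
by move=> w0; rewrite [w]tens_ffun_sum big1 // => t _; rewrite w0 /inj linear0.
Qed.

Lemma tens_ffun_proj_inj t t' (z : tens E N) :
  pr t (inj t' z) = if t == t' then z else 0.
Proof.
rewrite /pr /inj tens_map_comp; elim/tens_ind: z => [|x y|u v IHu IHv].
- by rewrite linear0 if_same.
- rewrite tens_mapE /= /ffun_proj ffunE; case: eqP => // _; exact: elem0l.
- by rewrite linearD /= IHu IHv; case: eqP; rewrite ?addr0.
Qed.
End FfunTensor.

(* This is Hom(P, E) (x) N = Hom(P, E (x) N), restricted by flatness of N to the
   maps that vanish on the image of d. In the proof Hom(P, E) is replaced by
   E^n, of which it is a direct factor. *)
Lemma linear_tens_decomp P P' E N (d : {linear P' -> P})
    (f : {linear P -> tens E N}) :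
  flat N -> projective P -> fin_generated P -> fin_generated P' ->
  f \o d =1 \0 ->
  exists k (h : 'I_k -> {linear P -> E}) (y : 'I_k -> N),
    (forall x, f x = \sum_i elem (h i x) (y i)) /\ forall i, h i \o d =1 \0.
Proof.
move=> flatN projP fgP [m [e' e'P]] fd.
have [n [e [c ec]]] := fg_projective_dual_basis projP fgP; have [c_lin cK] := ec.
(* The retraction of E^n onto Hom(P, E): each map is [phi] of the family of its values at [e]. *)
pose phi (v : {ffun 'I_n -> E}) (x : P) := \sum_i c i x *: v i.
have [|phiL phiE] := choice (fun v => @linear_build Q P E (phi v) _).
  move=> v a x y; rewrite /phi scaler_sumr -big_split; apply: eq_bigr => i _ /=.
  by rewrite c_lin scalerDl scalerA.
(* As [e'] generates [P'], [b v = 0] exactly when [phi v] vanishes on the image of [d]. *)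
have [b bE] : exists b : {linear {ffun 'I_n -> E} -> {ffun 'I_m -> E}},
    b =1 fun v => [ffun k => phi v (d (e' k))].
  apply: linear_build => a u v; apply/ffunP=> k; rewrite !ffunE /phi.
  rewrite scaler_sumr -big_split; apply: eq_bigr => i _ /=.
  by rewrite !ffunE scalerDr !scalerA mulrC.
(* The tensor that represents [f]: its component at [i] is [f (e i)]. *)
pose w : tens {ffun 'I_n -> E} N :=
  \sum_i tens_map (ffun_inj i : {linear _ -> _}) (idfun : {linear N -> N}) (f (e i)).
have bw k : tens_map (ffun_proj k : {linear _ -> _}) (idfun : {linear N -> N})
    (tens_map b (idfun : {linear N -> N}) w) = f (d (e' k)).
  rewrite [in RHS](cK (d (e' k))) [RHS]linear_sum.
  have -> : tens_map b (idfun : {linear N -> N}) w = \sum_i tens_map b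
      (idfun : {linear N -> N}) (tens_map (ffun_inj i : {linear _ -> _})
      (idfun : {linear N -> N}) (f (e i))) by rewrite linear_sum.
  rewrite linear_sum; apply: eq_bigr => i _.
  rewrite linearZ /= !tens_map_comp; elim/tens_ind: (f _) => [|x y|u v IHu IHv].
  - by rewrite !linear0.
  - rewrite [LHS]tens_mapE tens_scaleZ /= /ffun_proj bE ffunE /phi; congr elem.
    rewrite (bigD1 i) //= ffunE eqxx big1 ?addr0 // => j /negPf ji.
    by rewrite ffunE ji scaler0.
  - by rewrite linearD /= IHu IHv scalerDr.
(* By [bw] and [fd], [b] tensored with [N] kills [w], so [w] is a sum of terms [elem v y] with
   [b v = 0]; the maps [phi v] are the required ones. *)
have [|s ws gs] := @tens_ker _ _ N b w flatN.
  by apply: tens_ffun_eq0 => k; rewrite bw; apply: fd.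
pose t := tnth (in_tuple s).
exists (size s), (fun l => phiL (t l).1), (fun l => (t l).2); split=> [x|l].
  rewrite -(big_tnth _ _ s predT (fun p => elem (phiL p.1 x) p.2)).
  rewrite {1}(cK x) linear_sum.
  have fe i : f (e i) = \sum_(p <- s) elem (p.1 i) p.2.
    transitivity (tens_map (ffun_proj i : {linear _ -> _}) (idfun : {linear N -> N}) w).
      rewrite linear_sum (bigD1 i) //= tens_ffun_proj_inj eqxx.
      by rewrite big1 ?addr0 // => j ji; rewrite tens_ffun_proj_inj eq_sym (negPf ji).
    by rewrite ws tens_map_sum.
  rewrite [LHS](eq_bigr (fun i => \sum_(p <- s) elem (c i x *: p.1 i) p.2)).
    by rewrite exchange_big; apply: eq_bigr => p _ /=; rewrite phiE /phi elem_suml.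
  move=> i _; rewrite linearZ /= fe scaler_sumr.
  by apply: eq_bigr => p _; rewrite tens_scaleZ.
move=> z /=; rewrite phiE; have [a ->] := e'P z.
have /ffunP bq := gs _ (mem_tnth l (in_tuple s)).
have -> : d (\sum_k a k *: e' k) = \sum_k a k *: d (e' k).
  by rewrite linear_sum; apply: eq_bigr => k _; rewrite linearZ.
rewrite /phi (eq_bigr (fun i => \sum_k a k *: (c i (d (e' k)) *: (t l).1 i))).
  rewrite exchange_big big1 // => k _ /=; rewrite -scaler_sumr.
  by have := bq k; rewrite bE !ffunE /phi => ->; rewrite scaler0.
move=> i _; rewrite (dual_basis_lincomb ec) scaler_suml.
by apply: eq_bigr => k _; rewrite scalerA.
Qed.

End TensorTheory.

(** * Independence of Ext from the resolution *)

Section Comparison.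
Variables (S : pzRingType) (M : lmodType S).
Implicit Types (P T : proj_resolution M).

Lemma res_diff_diff P n z : res_diff P n (res_diff P n.+1 z) = 0.
Proof. by apply/res_exact; exists z. Qed.

Lemma res_aug_diff P z : res_aug P (res_diff P 0 z) = 0.
Proof. by apply/res_exact0; exists z. Qed.

(* Only two consecutive degrees of a comparison map are ever considered: this
   keeps the constructions below existential statements proved by induction. *)
Definition chain_map P T n (a0 : {linear P n -> T n})
    (a1 : {linear P n.+1 -> T n.+1}) : Prop :=
  res_diff T n \o a1 =1 a0 \o res_diff P n.

Lemma chain_map_succ P T n (a0 : {linear P n -> T n}) (a1 : {linear P n.+1 -> T n.+1}) :
  chain_map a0 a1 ->
  exists a2 : {linear P n.+2 -> T n.+2}, chain_map a1 a2.
Proof.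
move=> a01; apply: (@projective_lift _ _ _ _ (res_diff T n.+1)
  (a1 \o res_diff P n.+1 : {linear P n.+2 -> T n.+1})) => [|z].
  exact: res_projective.
apply/res_exact; have /= -> := a01 (res_diff P n.+1 z).
by rewrite res_diff_diff linear0.
Qed.

Lemma chain_map0 P T : exists (a0 : {linear P 0 -> T 0}) (a1 : {linear P 1 -> T 1}),
  res_aug T \o a0 =1 res_aug P /\ chain_map a0 a1.
Proof.
have [||a0 a0E] := @projective_lift _ _ _ _ (res_aug T) (res_aug P).
- exact: res_projective.
- by move=> p; apply: res_aug_surj.
have [||a1 a1E] := @projective_lift _ _ _ _ (res_diff T 0)
  (a0 \o res_diff P 0 : {linear P 1 -> T 0}).
- exact: res_projective.
- by move=> p; apply/res_exact0; have /= -> := a0E (res_diff P 0 p);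
    rewrite res_aug_diff.
by exists a0, a1; split.
Qed.

(** The comparison theorem in degree [n.+1], enough for Ext in positive degrees. The maps may change
    with [n]: no full chain map is built. *)
Lemma chain_homotopy P T n : exists (a0 : {linear P n -> T n})
    (a1 : {linear P n.+1 -> T n.+1}) (b0 : {linear T n -> P n})
    (b1 : {linear T n.+1 -> P n.+1}) (h0 : {linear P n -> P n.+1})
    (h1 : {linear P n.+1 -> P n.+2}),
  [/\ chain_map a0 a1, chain_map b0 b1 &
  forall y : P n.+1,
    y - b1 (a1 y) = res_diff P n.+1 (h1 y) + h0 (res_diff P n y)].
Proof.
elim: n => [|n [a0 [a1 [b0 [b1 [h0 [h1 [a01 b01 h01]]]]]]]].
  have [a0 [a1 [aE a01]]] := chain_map0 P T.
  have [b0 [b1 [bE b01]]] := chain_map0 T P.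
  have [||h0 h0E] := @projective_lift _ _ _ _ (res_diff P 0)
      (idfun \- (b0 \o a0) : {linear P 0 -> P 0}).
  - exact: res_projective.
  - move=> y; apply/res_exact0; rewrite /= linearB /=.
    by have /= -> := bE (a0 y); have /= -> := aE y; rewrite subrr.
  have [||h1 h1E] := @projective_lift _ _ _ _ (res_diff P 1)
      (idfun \- (b1 \o a1) \- (h0 \o res_diff P 0) : {linear P 1 -> P 1}).
  - exact: res_projective.
  - move=> y; apply/res_exact; rewrite /= !linearB /=.
    have /= -> := h0E (res_diff P 0 y); have /= -> := b01 (a1 y).
    by have /= -> := a01 y; rewrite subrr.
  exists a0, a1, b0, b1, h0, h1; split=> // y.
  by have /= -> := h1E y; rewrite subrK.
have [a2 a12] := chain_map_succ a01; have [b2 b12] := chain_map_succ b01.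
(* By [h01] the error [id - b2 a2 - h1 d] is killed by the differential, so exactness lets it
   lift. *)
have [||h2 h2E] := @projective_lift _ _ _ _ (res_diff P n.+2)
    (idfun \- (b2 \o a2) \- (h1 \o res_diff P n.+1) : {linear P n.+2 -> P n.+2}).
- exact: res_projective.
- move=> y; apply/res_exact; rewrite /= !linearB /=.
  have /= -> := b12 (a2 y); have /= -> := a12 y.
  by rewrite h01 res_diff_diff linear0 addr0 subrr.
exists a1, a2, b1, b2, h1, h2; split=> // y.
by have /= -> := h2E y; rewrite subrK.
Qed.

Lemma Ext_vanishes_resolution T (N : lmodType S) i : (0 < i)%N ->
  (forall f : {linear T i -> N}, cocycle f -> coboundary f) ->
  Ext_vanishes i M N.
Proof.
case: i => // i _ extT P f cf.
have [a0 [a1 [b0 [b1 [h0 [h1 [a01 b01 h01]]]]]]] := chain_homotopy P T i.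
have [|g gE] := extT (f \o b1 : {linear T i.+1 -> N}).
  (* No [b2] is at hand to show that [f \o b1] is a cocycle; exactness of [P] puts [b1 (d z)] in the
     image of the next differential instead. *)
  move=> z /=; suff /res_exact[w <-] : res_diff P i (b1 (res_diff T i.+1 z)) = 0.
    exact: cf.
  by have /= -> := b01 (res_diff T i.+1 z); rewrite res_diff_diff linear0.
(* Apply [f] to the homotopy formula: [f d h1] vanishes, and [f b1 a1 = g d a1 = g a0 d]. *)
exists ((g \o a0) \+ (f \o h0) : {linear P i -> N}) => y /=.
have /(congr1 f) := h01 y; rewrite linearB linearD /=.
have /= -> := cf (h1 y); rewrite add0r => <-.
by have /= <- := a01 y; have /= -> := gE (a1 y); rewrite addrC subrK.
Qed.

End Comparison.

(** * Maps from faithful modules *)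

Section FaithfulHom.
Variables (Q : comPzRingType) (E : lmodType Q).

(* McCoy's argument. Let r be maximal such that some r x r minor of a matrix of
   relations between the generators of E does not annihilate x; r < n because
   the n x n minors annihilate E. The cofactors along one more column, times x,
   then satisfy all relations of E and define a nonzero map E -> N. *)
Lemma fin_generated_faithful_Hom (N : lmodType Q) :
  fin_generated E -> (forall a : Q, (forall x : E, a *: x = 0) -> a = 0) ->
  (forall f : {linear E -> N}, f =1 \0) -> forall x : N, x = 0.
Proof.
move=> [n [e eP]] faithE hom0 x; apply: contrapT => xN0.
pose rel (a : 'I_n -> Q) := \sum_j a j *: e j = 0.
pose sub r (f : 'I_r -> 'I_n -> Q) (c : 'I_r -> 'I_n) := \matrix_(i, k) f i (c k).
pose minor r := exists f c, (forall i, rel (f i)) /\ \det (@sub r f c) *: x <> 0.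
have minor0 : minor 0%N.
  by exists (fun _ _ => 0), (widen_ord (leq0n n)); split=> [[]|] //;
    rewrite det_mx00 scale1r.
have minorn : ~ minor n.
  move=> [f [c [frel]]]; apply; suff -> : \det (sub n f c) = 0 by rewrite scale0r.
  (* A non-injective [c] repeats a column. Otherwise [c] is a permutation, and Cramer's rule shows
     that the determinant kills every generator of [E]. *)
  have [c_inj | /injectivePn[k1 [k2 k12 ck]]] := boolP (injectiveb c); last first.
    rewrite -det_tr; apply: (determinant_alternate k12) => i.
    by rewrite !mxE ck.
  move/injectiveP in c_inj; have c_bij := injF_bij c_inj.
  have rows i : \sum_k sub n f c i k *: e (c k) = 0.
    rewrite -[RHS](frel i) [RHS](reindex c) /=; last exact: onW_bij.
    by apply: eq_bigr => k _; rewrite mxE.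
  apply: faithE => y; have [a ->] := eP y; rewrite (reindex c) /=; last exact: onW_bij.
  rewrite scaler_sumr big1 // => k _; rewrite scalerA mulrC -scalerA.
  suff -> : \det (sub n f c) *: e (c k) = 0 by rewrite scaler0.
  transitivity (\sum_l (\adj (sub n f c) *m sub n f c) k l *: e (c l)).
    rewrite mul_adj_mx (bigD1 k) //= mxE eqxx mulr1n big1 ?addr0 // => l /negPf lk.
    by rewrite mxE eq_sym lk mulr0n scale0r.
  under eq_bigr => l _ do rewrite mxE scaler_suml.
  rewrite exchange_big big1 // => i _ /=.
  under eq_bigr => l _ do rewrite -scalerA.
  by rewrite -scaler_sumr rows scaler0.
have [r rn [[f [c [frel fx]]] minorS]] : exists2 r, (r < n)%N & minor r /\ ~ minor r.+1.
  apply: contrapT => nex; apply: minorn.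
  have: forall r, (r <= n)%N -> minor r; last exact.
  elim=> // r IHr rn; apply: contrapT => nr; apply: nex; exists r => //.
  by split=> //; apply: IHr; apply: ltnW.
have [j0 cj0] : exists j0, j0 \notin codom c.
  apply/existsP; apply: contraLR rn => /existsPn cn; rewrite -leqNgt.
  rewrite -[leqLHS]card_ord -[leqRHS]card_ord -(size_codom c).
  apply: leq_trans (card_size _); apply: subset_leq_card.
  by apply/subsetP => j _; have := cn j; rewrite negbK.
(* The new column [j0] and, in [f'], the new row [a] are put at index 0. *)
pose c' (k : 'I_r.+1) := oapp c j0 (unlift ord0 k).
pose f' (a : 'I_n -> Q) (i : 'I_r.+1) := oapp f a (unlift ord0 i).
(* Cofactors along row 0 do not depend on that row, which is filled with zeros. *)
pose cof k := cofactor (sub _ (f' (fun=> 0)) c') ord0 k.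
(* Summing over the fibre of [c'] avoids having to prove [c] injective. *)
pose v j := \sum_(k | c' k == j) cof k *: x.
have vrel a : rel a -> \sum_j a j *: v j = 0.
  (* Laplace expansion along row 0 of an [r.+1] minor, which kills [x] by the choice of [r]. *)
  move=> arel; transitivity (\det (sub _ (f' a) c') *: x); last first.
    apply: contrapT => ax; apply: minorS; exists (f' a), c'; split=> // i.
    by rewrite /f'; case: unliftP => [i' _|_]; [apply: frel | apply: arel].
  rewrite (expand_det_row _ ord0) scaler_suml (partition_big c' predT) //=.
  apply: eq_bigr => j _; rewrite scaler_sumr; apply: eq_bigr => k /eqP ckj.
  rewrite scalerA mxE /f' unlift_none /= ckj; congr (_ * _ *: x).
  rewrite /cof /cofactor; congr (_ * \det _); apply/matrixP => i l.
  by rewrite !mxE /f' liftK.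
have [||h hE] := @linear_factor _ _ _ _ (lincomb e : {linear _ -> _})
    (lincomb v : {linear _ -> _}).
- move=> y; have [a ->] := eP y; exists (\row_j a j).
  by apply: eq_bigr => j _; rewrite mxE.
- by move=> a; apply: vrel.
apply: fx; have := hE (delta_mx 0 j0); rewrite /= hom0 => /esym.
rewrite /lincomb (bigD1 j0) //= mxE !eqxx scale1r big1; last first.
  by move=> j /negPf jj0; rewrite mxE jj0 andbF scale0r.
(* As [c] misses [j0], only [k = 0] contributes to [v j0], which is thus the chosen [r] minor times
   [x]. *)
rewrite addr0 /v (big_pred1 ord0) => [<-|k]; last first.
  rewrite /c'; case: unliftP => [k' ->|->] /=; last by rewrite !eqxx.
  rewrite [RHS]eq_sym (negPf (neq_lift _ _)); apply: contraNF cj0 => /eqP <-.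
  exact: codom_f.
rewrite /cof /cofactor addn0 expr0 mul1r; congr (\det _ *: x).
by apply/matrixP => i k; rewrite !mxE /f' /c' !liftK.
Qed.

End FaithfulHom.

(** * Base change to an algebra *)

(** Bijectivity of homothety maps concerns equality of bundled linear maps; this makes it
    pointwise. *)
Lemma eq_linear (S : pzRingType) (U V : lmodType S) (f g : {linear U -> V}) :
  f =1 g -> f = g.
Proof.
case: f g => [f [[fD] [fZ]]] [g [[gD] [gZ]]] /= /funext fg; subst g.
by rewrite (Prop_irrelevance fD gD) (Prop_irrelevance fZ gZ).
Qed.

Lemma ascale_mul1 (Q : comPzRingType) (A : pzAlgType Q) (a : Q) (s : A) :
  ascale a 1 * s = ascale a s.
Proof. by rewrite -ascalerAl mul1r. Qed.

(** An alias, so that [N] can carry a Q-structure beside its A-structure. *)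
Definition restrict_scalars (Q : comPzRingType) (A : pzAlgType Q)
  (N : lmodType A) : Type := N.

Section RestrictScalars.
Variables (Q : comPzRingType) (A : pzAlgType Q) (N : lmodType A).

HB.instance Definition _ := GRing.Zmodule.on (restrict_scalars N).

Let rs (a : Q) (x : restrict_scalars N) : restrict_scalars N :=
  (ascale a 1 : A) *: (x : N).

Fact restrict_scalars_scalerA a b x : rs a (rs b x) = rs (a * b) x.
Proof. by rewrite /rs scalerA ascale_mul1 ascalerA. Qed.
Fact restrict_scalars_scale1r : left_id 1 rs.
Proof. by move=> x; rewrite /rs ascale1r scale1r. Qed.
Fact restrict_scalars_scalerDr : right_distributive rs +%R.
Proof. by move=> a x y; apply: scalerDr. Qed.
Fact restrict_scalars_scalerDl x : {morph rs^~ x : a b / a + b}.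
Proof. by move=> a b; rewrite /rs ascalerDl; apply: scalerDl. Qed.

HB.instance Definition _ := GRing.Zmodule_isLmodule.Build Q (restrict_scalars N)
  restrict_scalars_scalerA restrict_scalars_scale1r restrict_scalars_scalerDr
  restrict_scalars_scalerDl.
End RestrictScalars.

Section BaseChange.
Variables (Q : comPzRingType) (A : pzAlgType Q).
Implicit Types (E M P U V W : lmodType Q) (N : lmodType A).

Local Notation oneA := ((1 : A) : alg_mod A).

Lemma tens_alg_scaleE M (s y : A) (x : M) :
  s *: (elem x (y : alg_mod A) : tens_alg M A) = elem x (s * y : alg_mod A).
Proof. exact: tens_alg_lscaleE. Qed.

Lemma tens_alg_elem M (x : M) (y : A) :
  elem x (y : alg_mod A) = y *: (elem x oneA : tens_alg M A).
Proof. by rewrite tens_alg_scaleE mulr1. Qed.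

Lemma tens_alg_scale_ascale M (a : Q) (z : tens M (alg_mod A)) :
  (ascale a 1 : A) *: (z : tens_alg M A) = a *: z.
Proof.
elim/tens_ind: z => [|x y|u v IHu IHv]; first by rewrite !scaler0.
  by rewrite tens_alg_scaleE ascale_mul1 tens_scaleZ elemZ.
by rewrite [RHS]scalerDr -IHu -IHv; apply: (@scalerDr A (tens_alg M A)).
Qed.

Lemma eq_tens_alg_linear M N (f g : {linear tens_alg M A -> N}) :
  (forall x : M, f (elem x oneA) = g (elem x oneA)) -> f =1 g.
Proof.
move=> fg; elim/tens_ind=> [|x y|u v IHu IHv]; first by rewrite !linear0.
  by rewrite tens_alg_elem !linearZ fg.
by rewrite [LHS](linearD f) [RHS](linearD g) IHu IHv.
Qed.

(** Existence in the adjunction Hom_A(M (x) A, N) = Hom_Q(M, N); [eq_tens_alg_linear] is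
    uniqueness. *)
Lemma tens_alg_extend M N (f : {linear M -> restrict_scalars N}) :
  exists F : {linear tens_alg M A -> N},
    forall x y, F (elem x y) = (y : A) *: (f x : N).
Proof.
pose f0 (x : M) (y : alg_mod A) : N := (y : A) *: (f x : N).
have f0_bal : balanced f0.
  split=> [x x' y|x y y'|a x y]; rewrite /f0.
  - by rewrite linearD; apply: scalerDr.
  - exact: scalerDl.
  - rewrite linearZ; change ((y : A) *: ((ascale a 1 : A) *: (f x : N)) =
      (ascale a (y : A)) *: (f x : N)).
    by rewrite scalerA -ascalerAr mulr1.
have [|F FE] := @linear_build A (tens_alg M A) N (tens_lift f0).
  move=> s u v; rewrite tens_liftD //; congr (_ + _).
  elim/tens_ind: u => [|x y|u u' IHu IHu'].
  - by rewrite scaler0 tens_lift0 // scaler0.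
  - by rewrite tens_alg_scaleE !tens_liftE // /f0 scalerA.
  - rewrite [s *: _](@scalerDr A (tens_alg M A)).
    by rewrite !tens_liftD // scalerDr IHu IHu'.
by exists F => x y; rewrite FE tens_liftE.
Qed.

(** The inverse direction of the adjunction, with the target seen as a plain [tens] to suit
    [linear_tens_decomp]. *)
Lemma tens_alg_restrict P E (F : {linear tens_alg P A -> tens_alg E A}) :
  exists f : {linear P -> tens E (alg_mod A)}, forall x, f x = F (elem x oneA).
Proof.
apply: linear_build => a x y; rewrite elemDl -tens_scaleZ -!tens_alg_scale_ascale.
exact: (@linearP A _ _ _ F).
Qed.

(** A dual basis of [P] yields one over [A]: the elements [e i (x) 1], with coordinates induced by
    [c i]. *)
Lemma tens_alg_projective P : projective P -> fin_generated P ->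
  projective (tens_alg P A) /\ fin_generated (tens_alg P A).
Proof.
move=> projP fgP; have [n [e [c ec]]] := fg_projective_dual_basis projP fgP.
pose c0 i (x : P) (y : alg_mod A) : A := ascale (c i x) (y : A).
have c0_bal i : balanced (c0 i).
  split=> [x x' y|x y y'|a x y]; rewrite /c0.
  - by rewrite (dual_basisD ec) ascalerDl.
  - exact: ascalerDr.
  - by rewrite (dual_basisZ ec) mulrC -ascalerA.
apply: (@dual_basis_projective _ _ n (fun i => elem (e i) oneA : tens_alg P A)
  (fun i => tens_lift (c0 i))).
split=> [i s u v|z].
  rewrite tens_liftD //; congr (_ + _).
  elim/tens_ind: u => [|x y|u u' IHu IHu'].
  - by rewrite scaler0 tens_lift0 // mulr0.
  - by rewrite tens_alg_scaleE !tens_liftE // /c0 ascalerAr.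
  - rewrite [s *: _](@scalerDr A (tens_alg P A)).
    by rewrite !tens_liftD // mulrDr IHu IHu'.
elim/tens_ind: z => [|x y|u v IHu IHv].
- by rewrite big1 // => i _; rewrite tens_lift0 // scale0r.
- rewrite {1}(ec.2 x) elem_suml; apply: eq_bigr => i _.
  by rewrite tens_liftE // elemZ tens_alg_scaleE mulr1.
- rewrite {1}IHu {1}IHv -(@big_split (tens_alg P A)).
  by apply: eq_bigr => i _; rewrite tens_liftD // scalerDl.
Qed.

Section Map.
Variables (M M' : lmodType Q) (f : {linear M -> M'}).

Definition tens_alg_map : tens_alg M A -> tens_alg M' A :=
  tens_map f (idfun : {linear alg_mod A -> alg_mod A}).

Fact tens_alg_map_linear : linear tens_alg_map.
Proof.
move=> s u v; rewrite /tens_alg_map [LHS]linearD /=; congr (_ + _).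
elim/tens_ind: u => [|x y|u u' IHu IHu']; first by rewrite !(scaler0, linear0).
  by rewrite tens_alg_scaleE !tens_mapE; exact: (esym (tens_alg_scaleE _ _ _)).
rewrite [s *: _](@scalerDr A (tens_alg M A)) [LHS]linearD [tens_map _ _ (u + _)]linearD.
by rewrite /= IHu IHu'; apply/esym/(@scalerDr A (tens_alg M' A)).
Qed.
HB.instance Definition _ := GRing.isLinear.Build A (tens_alg M A)
  (tens_alg M' A) _ tens_alg_map tens_alg_map_linear.
End Map.

Section Resolution.
Variables (E : lmodType Q) (flatA : flat (alg_mod A)) (P : proj_resolution E).
Hypothesis fgP : forall n, fin_generated (P n).

Lemma tens_alg_map_surj U V (f : {linear U -> V}) :
  (forall x, exists y, f y = x) -> forall z, exists w, tens_alg_map f w = z.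
Proof.
move=> f_surj; elim/tens_ind=> [|x y|u v [u' <-] [v' <-]].
- by exists 0; rewrite linear0.
- by have [x' <-] := f_surj x; exists (elem x' y); rewrite /tens_alg_map tens_mapE.
- by exists (u' + v'); rewrite linearD.
Qed.

(** By flatness, via [tens_ker], a kernel element is a sum of terms with first factors in the kernel
    of [g], and each lifts through [f]. *)
Lemma tens_alg_map_exact U V W (f : {linear U -> V}) (g : {linear V -> W}) :
  (forall y, g y = 0 <-> exists z, f z = y) ->
  forall w, tens_alg_map g w = 0 <-> exists z, tens_alg_map f z = w.
Proof.
move=> fg w; split=> [gw|[z <-]]; last first.
  rewrite /tens_alg_map tens_map_comp; elim/tens_ind: z => [|x y|u v IHu IHv].
  - by rewrite linear0.
  - rewrite [LHS]tens_mapE /=; have -> : g (f x) = 0 by apply/fg; exists x.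
    exact: elem0l.
  - by rewrite linearD /= IHu IHv addr0.
have [s -> gs] := tens_ker flatA gw; elim: s gs {gw w} => [|p s IHs] gs.
  by exists 0; rewrite big_nil linear0.
have [|z zE] := IHs; first by move=> q sq; apply: gs; rewrite inE sq orbT.
have /fg[x xE] := gs p (mem_head _ _).
exists (elem x p.2 + z); rewrite linearD /= zE big_cons; congr (_ + _).
by rewrite /tens_alg_map tens_mapE xE.
Qed.

Definition tens_alg_resolution : proj_resolution (tens_alg E A : lmodType A) :=
  @ProjResolution A (tens_alg E A) (fun n => tens_alg (P n) A)
    (fun n => tens_alg_map (res_diff P n)) (tens_alg_map (res_aug P))
    (fun n => proj1 (tens_alg_projective (@res_projective _ _ P n) (fgP n)))
    (tens_alg_map_surj (@res_aug_surj _ _ P))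
    (tens_alg_map_exact (@res_exact0 _ _ P))
    (fun n => tens_alg_map_exact (@res_exact _ _ P n)).

End Resolution.
End BaseChange.

(** * Base change of semidualizing modules *)

Section Semidualizing.
Variables (Q : comPzRingType) (A : pzAlgType Q) (E : lmodType Q).
Hypotheses (flatA : flat (alg_mod A)) (sdE : semidualizing_module E).

Local Notation C := (tens_alg E A).
Local Notation oneA := ((1 : A) : alg_mod A).

Lemma semidualizing_faithful (a : Q) : (forall x : E, a *: x = 0) -> a = 0.
Proof.
move=> aE; apply: (bij_inj (sdm_homothety sdE)); apply: eq_linear => x /=.
by rewrite aE scale0r.
Qed.

Lemma semidualizing_endo (f : {linear E -> E}) : exists a : Q, forall x, f x = a *: x.
Proof.
have [h _ hK] := sdm_homothety sdE; exists (h f) => x.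
by rewrite -[in LHS](hK f).
Qed.

Lemma tens_alg_finite_resolution : has_degreewise_finite_resolution (C : lmodType A).
Proof.
have [P fgP] := sdm_resolution sdE; exists (tens_alg_resolution flatA fgP) => n.
exact: (tens_alg_projective A (@res_projective _ _ P n) (fgP n)).2.
Qed.

Lemma semidualizing_fin_generated : fin_generated E.
Proof.
have [P fgP] := sdm_resolution sdE; have [n [e eP]] := fgP 0%N.
exists n, (fun i => res_aug P (e i)) => x.
have [p <-] := res_aug_surj P x; have [a ->] := eP p; exists a.
by rewrite linear_sum; apply: eq_bigr => i _; rewrite linearZ.
Qed.

Lemma tens_alg_Ext i : (0 < i)%N -> Ext_vanishes i (C : lmodType A) (C : lmodType A).
Proof.
have [P fgP] := sdm_resolution sdE => i_gt0.
apply: (@Ext_vanishes_resolution _ _ (tens_alg_resolution flatA fgP)) => //.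
case: i i_gt0 => // i _ f cf; have [f0 f0E] := tens_alg_restrict f.
(* The cocycle [f] becomes a finite sum of E-valued cocycles [h l] with coefficients [y l]. Each
   [h l] is bounded by some [g l] over [Q], and the [g l] are reassembled with the same
   coefficients. *)
have [||||k [h [y [fh hd]]]] := @linear_tens_decomp _ _ _ _ _ (res_diff P i.+1) f0 flatA.
- exact: res_projective.
- exact: fgP.
- exact: fgP.
- move=> z /=; rewrite f0E; have /= := cf (elem z oneA).
  by rewrite /tens_alg_map tens_mapE.
have [g gh] := choice (fun l => sdm_ext sdE (isT : (0 < i.+1)%N) (hd l)).
have [|g0 g0E] := @linear_build Q (P i) (restrict_scalars C)
    (fun x => \sum_l elem (g l x) (y l) : tens E (alg_mod A)).
  move=> a u v; change (\sum_l elem (g l (a *: u + v)) (y l) =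
    (ascale a 1 : A) *: ((\sum_l elem (g l u) (y l) : tens E (alg_mod A)) : C)
    + \sum_l elem (g l v) (y l) :> tens E (alg_mod A)).
  rewrite tens_alg_scale_ascale scaler_sumr -big_split; apply: eq_bigr => l _ /=.
  by rewrite linearP elemDl tens_scaleZ.
have [G GE] := tens_alg_extend g0; exists G.
apply: (@eq_tens_alg_linear _ _ _ _
  (G \o tens_alg_map (res_diff P i) : {linear tens_alg (P i.+1) A -> C}) f) => x /=.
rewrite /tens_alg_map tens_mapE GE /= scale1r g0E -f0E fh.
by apply: eq_bigr => l _; have /= <- := gh l x.
Qed.

Lemma tens_alg_Hom_eq0 (N : lmodType A) :
  (forall f : {linear C -> N}, f =1 \0) -> forall x : N, x = 0.
Proof.
move=> hom0; apply: (@fin_generated_faithful_Hom _ _ (restrict_scalars N)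
  semidualizing_fin_generated semidualizing_faithful) => f x.
have [F FE] := tens_alg_extend f.
by have := hom0 F (elem x oneA); rewrite FE /= scale1r.
Qed.

Lemma tens_alg_endo (f : {linear C -> C}) : exists r : A, forall u, f u = rscale u r.
Proof.
have [P fgP] := sdm_resolution sdE; have [f0 f0E] := tens_alg_restrict f.
have [||||k [h [y [fh hd]]]] := @linear_tens_decomp _ _ _ _ _ (res_diff P 0)
  (f0 \o res_aug P : {linear P 0 -> tens E (alg_mod A)}) flatA.
- exact: res_projective.
- exact: fgP.
- exact: fgP.
- by move=> z /=; rewrite res_aug_diff linear0.
(* Each [h l] kills the image of [res_diff P 0], so it descends to an endomorphism of [E], which is
   a homothety. *)
have /choice[a ha] : forall l, exists a, forall p, h l p = a *: res_aug P p.
  move=> l; have [||g gE] := @linear_factor _ _ _ _ (res_aug P) (h l).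
  - exact: res_aug_surj.
  - by move=> p /res_exact0[z <-]; apply: hd.
  by have [a gZ] := semidualizing_endo g; exists a => p; have /= <- := gE p.
(* The sum of the [(a l *: x) (x) y l] is [x] tensored with this element. *)
exists (\sum_l ascale (a l) (y l : A)).
apply: (@eq_tens_alg_linear _ _ _ _ f (rmul _)) => x /=.
rewrite -f0E /rmul [RHS]tens_alg_rscaleE mul1r.
have [p <-] := res_aug_surj P x; have /= -> := fh p.
elim/big_rec2: _ => [|l s u _ ->]; first by rewrite elem0r.
by rewrite ha elemZ elemDr.
Qed.

(** As [E] is faithful and generated by the [e i], sending [a] to the family [a *: e i] embeds Q in
    E^n. By flatness this stays injective after tensoring, and 1 (x) r goes to the family e_i (x) r
    = 0. *)
Lemma tens_alg_rscale_inj (r : A) :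
  (forall x : E, rscale (elem x oneA : C) r = 0) -> r = 0.
Proof.
move=> xr; have [n [e eP]] := semidualizing_fin_generated.
have [|b bE] := @linear_build Q Q^o {ffun 'I_n -> E} (fun a => [ffun i => a *: e i]).
  by move=> a u v; apply/ffunP=> i; rewrite !ffunE scalerDl -scalerA.
have b_inj : injective b.
  move=> a a' /eqP; rewrite -subr_eq0 -linearB bE => /eqP/ffunP aa'.
  apply/eqP; rewrite -subr_eq0; apply/eqP/semidualizing_faithful => x.
  have [c ->] := eP x; rewrite scaler_sumr big1 // => i _.
  rewrite scalerA mulrC -scalerA; have := aa' i; rewrite !ffunE => ->.
  exact: scaler0.
have r0 : elem (1 : Q^o) (r : alg_mod A) = 0.
  apply: (flatA b_inj); rewrite linear0 tens_mapE; apply: tens_ffun_eq0 => i.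
  rewrite tens_mapE /= /ffun_proj bE ffunE scale1r -[RHS](xr (e i)).
  by rewrite [RHS]tens_alg_rscaleE mul1r.
(* The action map Q (x) A -> A recovers [r] from 1 (x) r. *)
have bal : balanced (fun (a : Q^o) (s : alg_mod A) => a *: s).
  split=> [a a' s|a s s'|a a' s]; [exact: scalerDl | exact: scalerDr |].
  by rewrite -scalerA scalerA mulrC -scalerA.
have := tens_liftE bal 1 (r : alg_mod A); rewrite r0 tens_lift0 //.
by rewrite scale1r => ->.
Qed.

End Semidualizing.

(** * Transport of resolutions and Ext along isomorphisms *)

Section Transport.
Variables (S : pzRingType) (M M' : lmodType S).
Variables (f : {linear M -> M'}) (g : {linear M' -> M}).
Hypotheses (fK : cancel f g) (gK : cancel g f).

(** Only the augmentation changes. The definition is transparent so that the terms reduce to those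
    of [P]. *)
Definition proj_resolution_iso (P : proj_resolution M) : proj_resolution M'.
Proof.
apply: (@ProjResolution S M' P (res_diff P) (f \o res_aug P : {linear P 0 -> M'})).
- exact: res_projective.
- by move=> x; have [y yx] := res_aug_surj P (g x); exists y; rewrite /= yx gK.
- move=> y; rewrite -res_exact0 /=; split=> [/(congr1 g)|->]; rewrite ?linear0 //.
  by rewrite fK.
- exact: res_exact.
Defined.

Lemma has_degreewise_finite_resolution_iso :
  has_degreewise_finite_resolution M -> has_degreewise_finite_resolution M'.
Proof. by move=> [P fgP]; exists (proj_resolution_iso P). Qed.

End Transport.

Lemma Ext_vanishes_iso (S : pzRingType) (M M' : lmodType S) (f : {linear M -> M'})
    (g : {linear M' -> M}) i :
  cancel f g -> cancel g f -> (0 < i)%N -> Ext_vanishes i M M -> Ext_vanishes i M' M'.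
Proof.
case: i => // i fK gK _ extM P h ch.
have [|k kE] := extM (proj_resolution_iso gK fK P) (g \o h : {linear P i.+1 -> M}).
  by move=> z; have /= -> := ch z; rewrite linear0.
exists (f \o k : {linear P i -> M'}) => z /=.
by have /= -> := kE z; rewrite gK.
Qed.

(** * Right modules and the opposite algebra *)

Section Converse.
Variables (Q : comPzRingType) (R : pzAlgType Q).

Let csc (a : Q) (x : R^c) : R^c := ascale a (x : R).

Fact converse_ascalerAl a u v : csc a (u * v) = csc a u * v.
Proof. exact: ascalerAr. Qed.
Fact converse_ascalerAr a u v : csc a (u * v) = u * csc a v.
Proof. exact: ascalerAl. Qed.

HB.instance Definition _ := PzRing_isPzAlgebra.Build Q R^c
  (@ascalerA Q R) (@ascale1r Q R) (@ascalerDr Q R) (@ascalerDl Q R)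
  converse_ascalerAl converse_ascalerAr.

Definition to_converse (x : alg_mod R) : alg_mod R^c := x.
Definition of_converse (x : alg_mod R^c) : alg_mod R := x.

Fact to_converse_linear : linear to_converse.
Proof. by []. Qed.
Fact of_converse_linear : linear of_converse.
Proof. by []. Qed.
HB.instance Definition _ := GRing.isLinear.Build Q (alg_mod R) (alg_mod R^c) _
  to_converse to_converse_linear.
HB.instance Definition _ := GRing.isLinear.Build Q (alg_mod R^c) (alg_mod R) _
  of_converse of_converse_linear.

Lemma flat_converse : flat (alg_mod R) -> flat (alg_mod R^c).
Proof.
move=> flatR U V f f_inj u v /(congr1 (tens_map (idfun : {linear V -> V})
  (of_converse : {linear _ -> _}))).
rewrite !tens_map_comp => uv.
have {}uv : tens_map f (idfun : {linear alg_mod R -> alg_mod R})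
    (tens_map (idfun : {linear U -> U}) (of_converse : {linear _ -> _}) u) =
  tens_map f (idfun : {linear alg_mod R -> alg_mod R})
    (tens_map (idfun : {linear U -> U}) (of_converse : {linear _ -> _}) v).
  by rewrite !tens_map_comp; move: uv; congr (_ = _); apply: eq_tens_map.
have /(congr1 (tens_map (idfun : {linear U -> U}) (to_converse : {linear _ -> _}))) :=
  flatR _ _ _ f_inj _ _ uv.
rewrite !tens_map_comp => H; rewrite -[u]tens_map_id -[v]tens_map_id.
by move: H; congr (_ = _); apply: eq_tens_map.
Qed.

Variable E : lmodType Q.

(** The isomorphism of left [R^c]-modules that carries the results on base change to [R^c] over to
    the right module C_R. *)
Definition tens_to_converse : right_mod (tens_alg E R) -> tens_alg E R^c :=
  tens_map (idfun : {linear E -> E}) (to_converse : {linear _ -> _}).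
Definition tens_of_converse : tens_alg E R^c -> right_mod (tens_alg E R) :=
  tens_map (idfun : {linear E -> E}) (of_converse : {linear _ -> _}).

Lemma tens_to_converseK : cancel tens_to_converse tens_of_converse.
Proof.
move=> u; rewrite /tens_to_converse /tens_of_converse tens_map_comp.
by rewrite -[RHS]tens_map_id; apply: eq_tens_map.
Qed.
Lemma tens_of_converseK : cancel tens_of_converse tens_to_converse.
Proof.
move=> u; rewrite /tens_to_converse /tens_of_converse tens_map_comp.
by rewrite -[RHS]tens_map_id; apply: eq_tens_map.
Qed.

Fact tens_to_converse_linear : linear tens_to_converse.
Proof.
move=> s u v; rewrite /tens_to_converse [LHS]linearD /=; congr (_ + _).
change (tens_map idfun to_converse (tens_alg_rscale (u : tens_alg E R) s) =
  tens_alg_lscale (s : R^c) (tens_map idfun to_converse (u : tens E (alg_mod R)))).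
elim/tens_ind: u => [|x y|u u' IHu IHu'].
- by rewrite tens_alg_rscale0 linear0 tens_alg_lscale0.
- by rewrite tens_alg_rscaleE !tens_mapE tens_alg_lscaleE.
- by rewrite tens_alg_rscalerDl !linearD /= IHu IHu' -tens_alg_scalerDr.
Qed.
HB.instance Definition _ := GRing.isLinear.Build R^c (right_mod (tens_alg E R))
  (tens_alg E R^c) _ tens_to_converse tens_to_converse_linear.

Fact tens_of_converse_linear : linear tens_of_converse.
Proof.
move=> s u v; apply: (can_inj tens_to_converseK).
by rewrite tens_of_converseK linearP /= !tens_of_converseK.
Qed.
HB.instance Definition _ := GRing.isLinear.Build R^c (tens_alg E R^c)
  (right_mod (tens_alg E R)) _ tens_of_converse tens_of_converse_linear.

(** Reduces (b1) for [R] to the statements on right multiplications over [R^c]. *)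
Lemma tens_of_converse_rscale (u : tens_alg E R^c) (s : R) :
  tens_of_converse (rscale u (s : R^c)) = (s *: (tens_of_converse u : tens_alg E R)).
Proof.
change (tens_of_converse (tens_alg_rscale u (s : R^c)) =
  tens_alg_lscale s (tens_of_converse u)).
elim/tens_ind: u => [|x y|u u' IHu IHu'].
- by rewrite tens_alg_rscale0 linear0 [RHS]tens_alg_lscale0.
- by rewrite /tens_of_converse tens_alg_rscaleE !tens_mapE [RHS]tens_alg_lscaleE.
- rewrite tens_alg_rscalerDl [LHS]linearD /= IHu IHu' -[LHS]tens_alg_scalerDr.
  by congr tens_alg_lscale; rewrite [RHS]linearD.
Qed.
End Converse.

Lemma inj_surj_bijective (X Y : Type) (f : X -> Y) :
  injective f -> (forall y, exists x, f x = y) -> bijective f.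
Proof.
move=> f_inj /choice[g gK]; exists g => // x; exact: f_inj.
Qed.

Theorem proposition3p7 (Q : comPzRingType) (R : pzAlgType Q) (E : lmodType Q) :
  flat (alg_mod R) -> semidualizing_module E ->
  faithfully_semidualizing (tens_alg E R : bimodType R R).
Proof.
move=> flatR sdE; have flatRc := flat_converse flatR.
pose toC : {linear right_mod (tens_alg E R) -> tens_alg E R^c} :=
  @tens_to_converse Q R E.
pose ofC : {linear tens_alg E R^c -> right_mod (tens_alg E R)} :=
  @tens_of_converse Q R E.
have toK : cancel toC ofC := @tens_to_converseK Q R E.
have ofK : cancel ofC toC := @tens_of_converseK Q R E.
split.
- split.
  + exact: tens_alg_finite_resolution.
  + exact: (has_degreewise_finite_resolution_iso ofK toK
      (tens_alg_finite_resolution flatRc sdE)).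
  + apply: inj_surj_bijective => [r r' rr'|F].
      have rE u : r *: (u : tens_alg E R) = r' *: u.
        exact: (congr1 (fun F : {linear right_mod (tens_alg E R) ->
          right_mod (tens_alg E R)} => F u) rr').
      apply/eqP; rewrite -subr_eq0; apply/eqP.
      apply: (tens_alg_rscale_inj flatRc sdE) => x; apply: (can_inj ofK).
      rewrite [RHS](linear0 ofC) [LHS]tens_of_converse_rscale.
      by rewrite scalerBl rE subrr.
    (* Conjugated by [toC], [F] is an endomorphism over [R^c], hence a right multiplication there,
       that is, left multiplication by [r] on C. *)
    have [r rE] := tens_alg_endo flatRc sdE (toC \o F \o ofC : {linear _ -> _}).
    exists r; apply: eq_linear => u; rewrite -[in RHS](toK u).
    apply: (can_inj toK); rewrite [RHS]rE; apply: (can_inj ofK).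
    by rewrite [RHS]tens_of_converse_rscale toK [ofC _]toK.
  + apply: inj_surj_bijective => [r r' rr'|F].
      have rE u : rscale (u : tens_alg E R) r = rscale u r'.
        exact: (congr1 (fun F : {linear tens_alg E R -> tens_alg E R} => F u) rr').
      apply/eqP; rewrite -subr_eq0; apply/eqP.
      apply: (tens_alg_rscale_inj flatR sdE) => x.
      by apply: (addIr (rscale (elem x ((1 : R) : alg_mod R) : tens_alg E R) r'));
        rewrite -rscalerDr subrK rE add0r.
    have [r rE] := tens_alg_endo flatR sdE F.
    by exists r; apply: eq_linear => u; rewrite rE.
  + by move=> i; apply: tens_alg_Ext.
  + move=> i i_gt0; apply: (Ext_vanishes_iso ofK toK i_gt0).
    exact: tens_alg_Ext.
- exact: tens_alg_Hom_eq0.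
- move=> M hom0; apply: (tens_alg_Hom_eq0 sdE) => f u.
  by have := hom0 (f \o toC : {linear right_mod (tens_alg E R) -> M}) (ofC u);
    rewrite /= ofK.
Qed.
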